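(* Let $A$ be an $n\times n$ complex matrix that is a strict contraction, with singular values ordered as $0\le r_n\le\cdots\le r_2\le r_1<1$ (so that $1$ is not an eigenvalue of $A$). Put $H=(I-A^* )^{-1}(I-A^*A)(I-A)^{-1}$. Then for every $k=1,2,\dots,n$ and every sequence of integers $1\le i_1<\cdots<i_k\le n$, the following inequalities hold: $$\lambda_j(H)\le\frac{1+r_j}{1-r_j},\qquad j=1,2,\dots,n,$$ $$\prod_{j=1}^k\lambda_{i_j}(H)\le\prod_{j=1}^k\frac{1+r_{i_j}}{1-r_{i_j}}\le\prod_{j=1}^k\frac{1+r_j}{1-r_j},$$ $$\prod_{j=1}^k\lambda_{n-i_j+1}(H)\ge\prod_{j=1}^k\frac{1-r_{i_j}^2}{(1+r_j)^2}\ge\prod_{j=1}^k\frac{1-r_j}{1+r_j}.$$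
   Context: $I$ is the $n\times n$ identity matrix and $X^*$ denotes the conjugate transpose of $X$. A strict contraction is a matrix all of whose singular values are less than $1$. For an $n\times n$ matrix $X$ with real eigenvalues (such as the Hermitian matrix $H$), the eigenvalues are counted with multiplicity and arranged in non-increasing order $\lambda_1(X)\ge\lambda_2(X)\ge\cdots\ge\lambda_n(X)$. *)

(* Defs.v *)
From mathcomp Require Import all_boot all_order all_algebra.
From mathcomp Require Import complex reals.

Set Implicit Arguments.
Unset Strict Implicit.
Unset Printing Implicit Defensive.

Import Order.TTheory GRing.Theory Num.Theory.
Local Open Scope ring_scope.
Local Open Scope complex_scope.
Local Open Scope sesquilinear_scope.

Section Eigenvalues.
Context {R : realType} {n : nat}.
Implicit Types X A : 'M[R[i]]_n.

(* The roots of the characteristic polynomial, with multiplicity. *)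
Definition spectrum X : seq R[i] :=
  sval (closed_field_poly_normal (char_poly X)).

(* Meant for matrices with real eigenvalues, on which taking real parts loses
   nothing (see [char_poly_eigval]). *)
Definition eigenvalues X : seq R :=
  sort >=%R [seq complex.Re z | z <- spectrum X].

(* Indices start at 0: [eigval X j] is $\lambda_{j+1}(X)$ for j < n. *)
Definition eigval X (j : nat) : R := (eigenvalues X)`_j.

(* Likewise [singval A j] is the (j+1)-st largest singular value of A. *)
Definition singval A (j : nat) : R := Num.sqrt (eigval (A^t* *m A) j).

Definition strict_contraction A : Prop := forall j : 'I_n, singval A j < 1.

Lemma char_poly_spectrum X :
  char_poly X = \prod_(z <- spectrum X) ('X - z%:P).
Proof.
rewrite /spectrum; case: closed_field_poly_normal => s /= {1}->.
by rewrite (eqP (char_poly_monic X)) scale1r.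
Qed.

Lemma size_eigenvalues X : size (eigenvalues X) = n.
Proof.
rewrite size_sort size_map; apply: succn_inj.
by rewrite -(size_char_poly X) char_poly_spectrum size_prod_XsubC.
Qed.

Lemma eigval_noninc X (j k : nat) :
  (j <= k < n)%N -> eigval X k <= eigval X j.
Proof.
case/andP=> jk kn.
have tr : transitive (>=%R : rel R) by move=> y x z /= xy yz; apply: le_trans xy.
have so : sorted >=%R (eigenvalues X).
  by apply: sort_sorted => x y /=; apply: le_total.
apply: (sorted_leq_nth tr (@lexx _ R) 0 so) => //.
  by rewrite inE size_eigenvalues (leq_ltn_trans jk).
by rewrite inE size_eigenvalues.
Qed.

Lemma char_poly_eigval X :
  (forall z, eigenvalue X z -> z \is Num.real) ->
  char_poly X = \prod_(j < n) ('X - ((eigval X j)%:C)%:P).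
Proof.
move=> realX.
transitivity (\prod_(x <- eigenvalues X) ('X - (x%:C)%:P)); last first.
  by rewrite (big_nth 0) size_eigenvalues big_mkord.
rewrite (perm_big [seq complex.Re z | z <- spectrum X]) ?perm_sort //=.
rewrite big_map char_poly_spectrum; apply: eq_big_seq => z zX.
rewrite RRe_real // realX // eigenvalue_root_char char_poly_spectrum.
by rewrite root_prod_XsubC.
Qed.

End Eigenvalues.

(* Main.v *)
Require Import Defs.
From mathcomp Require Import all_boot all_order all_algebra.
From mathcomp Require Import complex reals.
From mathcomp Require Import perm ring.

Import Order.TTheory GRing.Theory Num.Theory.
Local Open Scope ring_scope.
Local Open Scope complex_scope.
Local Open Scope sesquilinear_scope.

(** Fix an index j and write r for the j-th singular value of A.  The right
    singular vectors of A for the j-th and smaller singular values span a space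
    on which |A y| <= r |y|.  There the triangle inequality
    |y| - |A y| <= |y - A y| <= |y| + |A y| gives
      (1 - r) / (1 + r) * |y - A y|^2 <= |y|^2 - |A y|^2
                                      <= (1 + r) / (1 - r) * |y - A y|^2
    ([dotmx_contraction_bounds]).  With x = (I - A) y the middle term is the
    value at x of the quadratic form of H, so the Rayleigh quotients of H on the
    image of that space under I - A lie between (1 - r) / (1 + r) and
    (1 + r) / (1 - r).  The invertible I - A preserves dimensions, and
    Courant-Fischer ([eigval_le_max], [eigval_ge_min]) then bounds the j-th
    largest eigenvalue of H above ([eigval_cayley_le]) and the j-th smallest
    one below ([eigval_cayley_ge]).

    All the product inequalities hold factor by factor.  The only ingredient
    besides the two bounds is that a strictly increasing i satisfies j <= i_j,
    hence r_{i_j} <= r_j; in particular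
      (1 - r_{i_j}^2) / (1 + r_j)^2 <= (1 - r_{i_j}^2) / (1 + r_{i_j})^2
                                     = (1 - r_{i_j}) / (1 + r_{i_j}).

    Vectors are rows, so that the vector A y of the argument above appears as
    [y *m A^t*] and the quadratic form of X at x as [dotmx (x *m X) x]. *)

(** * Inner products and characteristic polynomials *)

Lemma char_poly_conj {K : fieldType} (n : nat) (P X : 'M[K]_n) :
  P \in unitmx -> char_poly (invmx P *m X *m P) = char_poly X.
Proof.
move=> Pu; rewrite /char_poly.
have -> : char_poly_mx (invmx P *m X *m P) =
  map_mx polyC (invmx P) *m char_poly_mx X *m map_mx polyC P.
  rewrite /char_poly_mx mulmxBr mulmxBl !map_mxM/= (scalar_mxC 'X).
  rewrite -(mulmxA 'X%:M) -(map_mxM polyC (invmx P) P) mulVmx //.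
  by rewrite map_mx1 mulmx1.
rewrite !det_mulmx mulrAC -det_mulmx -map_mxM mulVmx // map_mx1 det1.
by rewrite mul1r.
Qed.

Lemma capmx_nonzero {K : fieldType} (p q m : nat) (V : 'M[K]_(p, m))
    (W : 'M[K]_(q, m)) :
  (m < \rank V + \rank W)%N ->
  exists2 x : 'rV_m, x != 0 & (x <= V)%MS && (x <= W)%MS.
Proof.
move=> big; have /rowV0Pn[x xVW x_neq0] : (V :&: W)%MS != 0.
  rewrite -mxrank_eq0; apply: contraTneq big => cap0.
  by rewrite -mxrank_sum_cap cap0 addn0 -leqNgt rank_leq_col.
by exists x; rewrite -?sub_capmx.
Qed.

Local Notation "''[' u , v ]" := (dotmx u v) : ring_scope.
Local Notation "''[' u ]" := '[u, u]%R : ring_scope.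

Lemma dotmx_mul_adj {C : numClosedFieldType} (m n : nat)
    (u : 'rV[C]_m) (v : 'rV[C]_n) (X : 'M[C]_(m, n)) :
  '[u *m X, v] = '[u, v *m X^t*].
Proof. by rewrite !dotmxE trmx_mul map_mxM trmxCK mulmxA. Qed.

(** With a, b, c the lengths of y, z and y - z, the triangle inequality reads
    a - b <= c <= a + b, and both claims reduce to b <= r * a because
    (1 + r) * (a - b) - (1 - r) * (a + b) = 2 * (r * a - b). *)
Lemma dotmx_contraction_bounds {C : numClosedFieldType} (n : nat)
    (y z : 'rV[C]_n) (r : C) :
  0 <= r -> r <= 1 -> '[z] <= r ^+ 2 * '[y] ->
  (1 - r) * ('[y] - '[z]) <= (1 + r) * '[y - z] /\
  (1 - r) * '[y - z] <= (1 + r) * ('[y] - '[z]).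
Proof.
move=> r_ge0 r1 zy.
pose a := sqrtC '[y]; pose b := sqrtC '[z]; pose c := sqrtC '[y - z].
have [a_ge0 b_ge0 c_ge0] : [/\ 0 <= a, 0 <= b & 0 <= c].
  by split; rewrite sqrtC_ge0 dnorm_ge0.
have b_le : b <= r * a.
  by rewrite -ler_sqr ?nnegrE ?mulr_ge0 // exprMn !sqrtCK.
have c_le : c <= a + b.
  by have := triangle_lerif (@dotmx C n) y (- z); rewrite hnormN => -[].
have a_le : a - b <= c.
  rewrite lerBlDr.
  by have [] := triangle_lerif (@dotmx C n) (y - z) z; rewrite subrK.
have ab : b <= a by rewrite (le_trans b_le) // ler_piMl.
have c_lo : (a - b) ^+ 2 <= c ^+ 2 by rewrite lerXn2r ?nnegrE ?subr_ge0.
have c_hi : c ^+ 2 <= (a + b) ^+ 2 by rewrite lerXn2r ?nnegrE ?addr_ge0.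
have -> : '[y] = a ^+ 2 by rewrite sqrtCK.
have -> : '[z] = b ^+ 2 by rewrite sqrtCK.
have -> : '[y - z] = c ^+ 2 by rewrite sqrtCK.
have r1_ge0 : 0 <= 1 - r by rewrite subr_ge0.
split.
  apply: (le_trans _ (ler_wpM2l _ c_lo)); last by rewrite addr_ge0.
  rewrite -subr_ge0.
  have -> : (1 + r) * (a - b) ^+ 2 - (1 - r) * (a ^+ 2 - b ^+ 2)
      = 2 * (a - b) * (r * a - b) by ring.
  by rewrite !mulr_ge0 ?subr_ge0.
apply: (le_trans (ler_wpM2l r1_ge0 c_hi)).
rewrite -subr_ge0.
have -> : (1 + r) * (a ^+ 2 - b ^+ 2) - (1 - r) * (a + b) ^+ 2
    = 2 * (a + b) * (r * a - b) by ring.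
by rewrite !mulr_ge0 ?subr_ge0 ?addr_ge0.
Qed.

(** * Courant-Fischer bounds *)

Section CourantFischer.
Context {R : realType} {n : nat}.
Implicit Types X : 'M[R[i]]_n.

(** A unitary diagonalization lists the eigenvalues in an arbitrary order.
    Since it determines the characteristic polynomial, this list is a
    permutation of the sorted one, and its eigenvectors can be permuted along. *)
Lemma hermitian_orthonormal_eigvecs X : X^t* = X ->
  exists2 P : 'M[R[i]]_n, P \is unitarymx
    & forall j, row j P *m X = (eigval X j)%:C *: row j P.
Proof.
move=> Xherm.
have hX : X \is hermsymmx by apply/is_hermitianmxP; rewrite expr0 scale1r.
have /orthomx_spectralP defX := hermitian_normalmx hX.
set P := spectralmx X in defX; set d := spectral_diag X in defX.
have Pu : P \is unitarymx by exact: spectral_unitarymx.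
have dreal := hermitian_spectral_diag_real hX.
have speX : perm_eq (spectrum X) [seq d 0 i | i : 'I_n].
  apply: prod_XsubC_eq; rewrite -char_poly_spectrum {1}defX.
  rewrite char_poly_conj ?unitarymx_unit // char_poly_trig ?diag_mx_is_trig //.
  by rewrite big_image; apply: eq_bigr => i _; rewrite mxE eqxx.
have eigX : perm_eq (eigenvalues X) [tuple complex.Re (d 0 i) | i < n].
  rewrite perm_sort (perm_trans (perm_map _ speX)) //.
  by rewrite -map_comp.
have /tuple_permP[s defs] := eigX.
have eigE (j : 'I_n) : (eigval X j)%:C = d 0 (s j).
  rewrite /eigval defs (nth_map j) ?size_enum_ord // tnth_mktuple nth_ord_enum.
  by rewrite RRe_real //; apply: (mxOverP dreal).
exists (rowsub s P) => [|j].
  apply/row_unitarymxP => i j; rewrite !row_rowsub (row_unitarymxP Pu).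
  by rewrite (inj_eq perm_inj).
rewrite row_rowsub eigE -row_mul {1}defX !mulmxA mulmxV ?unitarymx_unit //.
by rewrite mul1mx row_mul row_diag_mx -scalemxAl -rowE.
Qed.

(** The coefficients a are the squared moduli of the coordinates of x in the
    orthonormal family of eigenvectors selected by f. *)
Lemma eigenvectors_span X m (f : 'I_m -> 'I_n) : X^t* = X -> injective f ->
  exists2 V : 'M[R[i]]_(m, n), \rank V = m &
    forall x : 'rV_n, (x <= V)%MS -> exists2 a : 'I_m -> R[i],
      (forall i, 0 <= a i) &
      '[x] = \sum_i a i /\ '[x *m X, x] = \sum_i (eigval X (f i))%:C * a i.
Proof.
move=> /hermitian_orthonormal_eigvecs[P Pu PX] f_inj.
have Vu : rowsub f P \is unitarymx.
  apply/row_unitarymxP => i j; rewrite !row_rowsub (row_unitarymxP Pu).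
  by rewrite (inj_eq f_inj).
exists (rowsub f P) => [|_ /submxP[y ->]]; first exact: mxrank_unitary.
have VX : rowsub f P *m X = diag_mx (\row_i (eigval X (f i))%:C) *m rowsub f P.
  apply/row_matrixP => i; rewrite !row_mul row_diag_mx -scalemxAl -rowE.
  by rewrite row_rowsub PX mxE.
exists (fun i => `|y 0 i| ^+ 2) => [i|]; first by rewrite exprn_ge0.
rewrite -mulmxA VX mulmxA !(dotmx_mul_adj _ _ _ _ (rowsub f P)) !mulmxtVK //.
rewrite !dotmxE !mxE.
split; apply: eq_bigr => i _; rewrite !mxE normCK //.
rewrite (bigD1 i) //= big1 ?addr0 => [|k /negbTE ki]; last first.
  by rewrite !mxE ki mulr0n mulr0.
by rewrite !mxE eqxx mulr1n mulrAC mulrC mulrA.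
Qed.

(** V is spanned by eigenvectors for the j.+1 largest eigenvalues. *)
Lemma eigval_top_span X (j : 'I_n) : X^t* = X ->
  exists2 V : 'M[R[i]]_(j.+1, n), \rank V = j.+1 &
    forall x : 'rV_n, (x <= V)%MS -> (eigval X j)%:C * '[x] <= '[x *m X, x].
Proof.
move=> Xh; have [] := @eigenvectors_span X _ (widen_ord (ltn_ord j)) Xh.
  by move=> a b /(congr1 val) /= /val_inj.
move=> V rV VX; exists V => // x /VX[a a_ge0 [-> ->]].
rewrite mulr_sumr ler_sum // => i _; rewrite ler_wpM2r // lecR.
by apply: eigval_noninc; rewrite /= leq_ord ltn_ord.
Qed.

(** V is spanned by eigenvectors for the n - j smallest eigenvalues. *)
Lemma eigval_bottom_span X (j : 'I_n) : X^t* = X ->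
  exists2 V : 'M[R[i]]_(n - j, n), \rank V = (n - j)%N &
    forall x : 'rV_n, (x <= V)%MS -> '[x *m X, x] <= (eigval X j)%:C * '[x].
Proof.
move=> Xh.
have jn (i : 'I_(n - j)) : (i + j < n)%N by rewrite addnC -ltn_subRL.
have [] := @eigenvectors_span X _ (fun i => Ordinal (jn i)) Xh.
  by move=> a b /(congr1 val) /= /addIn/val_inj.
move=> V rV VX; exists V => // x /VX[a a_ge0 [-> ->]].
rewrite mulr_sumr ler_sum // => i _; rewrite ler_wpM2r // lecR.
by rewrite eigval_noninc //= leq_addl jn.
Qed.

(** Since (n - j) + j.+1 > n, W meets the span of eigenvectors for the j.+1
    largest eigenvalues, and a common nonzero vector has a Rayleigh quotient
    between the j-th eigenvalue and c. *)
Lemma eigval_le_max X (j : 'I_n) (p : nat) (W : 'M[R[i]]_(p, n)) (c : R) :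
  X^t* = X -> (n - j <= \rank W)%N ->
  (forall x : 'rV_n, (x <= W)%MS -> '[x *m X, x] <= c%:C * '[x]) ->
  eigval X j <= c.
Proof.
move=> Xh rW WX; have [V rV VX] := eigval_top_span X j Xh.
have [|x x_neq0 /andP[/VX lo /WX hi]] := @capmx_nonzero _ _ _ _ V W.
  by rewrite rV addSn ltnS -leq_subLR.
by rewrite -lecR -(ler_pM2r (_ : 0 < '[x])) ?dnorm_gt0 // (le_trans lo).
Qed.

(** Here W meets the span of eigenvectors for the n - j smallest eigenvalues. *)
Lemma eigval_ge_min X (j : 'I_n) (p : nat) (W : 'M[R[i]]_(p, n)) (c : R) :
  X^t* = X -> (j < \rank W)%N ->
  (forall x : 'rV_n, (x <= W)%MS -> c%:C * '[x] <= '[x *m X, x]) ->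
  c <= eigval X j.
Proof.
move=> Xh rW WX; have [V rV VX] := eigval_bottom_span X j Xh.
have [|x x_neq0 /andP[/VX hi /WX lo]] := @capmx_nonzero _ _ _ _ V W.
  by rewrite rV -[X in (X < _)%N](subnK (ltnW (ltn_ord j))) ltn_add2l.
by rewrite -lecR -(ler_pM2r (_ : 0 < '[x])) ?dnorm_gt0 // (le_trans lo).
Qed.

End CourantFischer.

(** * Singular values *)

Section SingularValues.
Context {R : realType} {n : nat}.
Implicit Types A : 'M[R[i]]_n.

Lemma gram_herm A : (A^t* *m A)^t* = A^t* *m A.
Proof. by rewrite trmx_mul map_mxM trmxCK. Qed.

Lemma dotmx_gram A (x : 'rV_n) : '[x *m (A^t* *m A), x] = '[x *m A^t*].
Proof. by rewrite mulmxA dotmx_mul_adj. Qed.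

Lemma adjmx1B A : (1%:M - A)^t* = 1%:M - A^t*.
Proof. by rewrite linearB map_mxB /= trmx1 map_mx1. Qed.

(** The square root loses nothing because the quadratic form of the Gram matrix,
    hence each of its eigenvalues, is nonnegative. *)
Lemma singval_sqr A (j : 'I_n) : singval A j ^+ 2 = eigval (A^t* *m A) j.
Proof.
rewrite sqr_sqrtr //; apply: (eigval_ge_min _ _ _ 1%:M) => [||x _].
- exact: gram_herm.
- by rewrite mxrank1.
- by rewrite mul0r dotmx_gram dnorm_ge0.
Qed.

Lemma singval_noninc A (j k : nat) :
  (j <= k < n)%N -> singval A k <= singval A j.
Proof. by move=> jk; rewrite ler_wsqrtr // eigval_noninc. Qed.

Lemma singval_bottom_span A (j : 'I_n) :
  exists2 V : 'M[R[i]]_(n - j, n), \rank V = (n - j)%N &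
    forall x : 'rV_n, (x <= V)%MS ->
      '[x *m A^t*] <= (singval A j)%:C ^+ 2 * '[x].
Proof.
have [V rV VA] := eigval_bottom_span _ j (gram_herm A).
exists V => // x /VA; rewrite dotmx_gram -singval_sqr.
by rewrite rmorphXn.
Qed.

(** A vector fixed by the adjoint of A is no longer than the largest singular
    value times itself, hence zero. *)
Lemma strict_contraction_unit A : strict_contraction A -> 1%:M - A \in unitmx.
Proof.
move=> Ac; rewrite -unitmx_tr -(map_unitmx Num.conj) adjmx1B.
rewrite -row_free_unit -kermx_eq0; apply/eqP/row_matrixP => i; rewrite row0.
have := row_sub i (kermx (1%:M - A^t*)); move: (row i _) => y /sub_kermxP.
rewrite mulmxBr mulmx1 => /subr0_eq yA.
pose j0 : 'I_n := Ordinal (leq_ltn_trans (leq0n i) (ltn_ord i)).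
have [V rV VA] := singval_bottom_span A j0.
have /VA : (y <= V)%MS by rewrite submx_full // /row_full rV subn0.
rewrite -yA => y_le; apply/eqP; rewrite -(dnorm_eq0 (@dotmx _ n)).
have: (1 - (singval A j0)%:C ^+ 2) * '[y] <= 0 by rewrite mulrBl mul1r subr_le0.
rewrite pmulr_rle0; last first.
  by rewrite subr_gt0 expr_lt1 // ?ltcR ?lecR ?Ac ?sqrtr_ge0.
by move=> le0; rewrite eq_le le0 dnorm_ge0.
Qed.

End SingularValues.

(** * The real part of the Cayley transform *)

Section Cayley.
Context {R : realType} {n : nat}.
Implicit Types A B G : 'M[R[i]]_n.

Lemma adj_invmx_congr G B : G^t* = G ->
  (invmx (B^t*) *m G *m invmx B)^t* = invmx (B^t*) *m G *m invmx B.
Proof.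
have adj_inv (M : 'M[R[i]]_n) : (invmx M)^t* = invmx (M^t*).
  by rewrite trmx_inv map_invmx.
move=> Gh; rewrite !trmx_mul !map_mxM !adj_inv Gh.
by rewrite trmxCK mulmxA.
Qed.

(** Congruence is a change of variable: at the image x of y under the adjoint of
    B, the congruent form takes the value of G at y. *)
Lemma form_invmx_congr G B (y : 'rV_n) : B \in unitmx ->
  '[y *m B^t* *m (invmx (B^t*) *m G *m invmx B), y *m B^t*] = '[y *m G, y].
Proof.
move=> Bu; rewrite -dotmx_mul_adj !mulmxA mulmxKV ?mulmxK //.
by rewrite map_unitmx unitmx_tr.
Qed.

Lemma form_one_sub_gram A (y : 'rV_n) :
  '[y *m (1%:M - A^t* *m A), y] = '[y] - '[y *m A^t*].
Proof. by rewrite mulmxBr mulmx1 linearBl /= dotmx_gram. Qed.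

(** The Hermitian part of the Cayley transform (1 + A) (1 - A)^-1: multiplying
    it by 1 - A^* on the left and 1 - A on the right gives
    ((1 - A^* ) (1 + A) + (1 + A^* ) (1 - A)) / 2 = 1 - A^* A. *)
Definition cayley_re A : 'M[R[i]]_n :=
  invmx (1%:M - A^t*) *m (1%:M - A^t* *m A) *m invmx (1%:M - A).

Lemma cayley_re_herm A : (cayley_re A)^t* = cayley_re A.
Proof.
rewrite /cayley_re -adjmx1B adj_invmx_congr // linearB /= map_mxB gram_herm.
by rewrite trmx1 map_mx1.
Qed.

(** W is the image under 1 - A of the span of the right singular vectors for
    the n - j smallest singular values. *)
Lemma cayley_re_rayleigh A (j : 'I_n) (r := singval A j) :
  strict_contraction A ->
  exists2 W : 'M[R[i]]_(n - j, n), \rank W = (n - j)%N &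
    forall x : 'rV_n, (x <= W)%MS ->
      ((1 - r) / (1 + r))%:C * '[x] <= '[x *m cayley_re A, x]
        <= ((1 + r) / (1 - r))%:C * '[x].
Proof.
move=> Ac; have Bu := strict_contraction_unit _ Ac.
have [V rV VA] := singval_bottom_span A j.
exists (V *m (1%:M - A^t*)) => [|x].
  by rewrite mxrankMfree // row_free_unit -adjmx1B map_unitmx unitmx_tr.
move=> /submxP[y ->]; rewrite mulmxA; move: (submxMl y V); move: (y *m V) => {}y.
move=> /VA y_le; rewrite /cayley_re -adjmx1B form_invmx_congr // adjmx1B.
rewrite form_one_sub_gram mulmxBr mulmx1.
have r_ge0 : 0 <= r%:C :> R[i] by rewrite ler0c sqrtr_ge0.
have r_lt1 : r%:C < 1 :> R[i] by rewrite ltcR Ac.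
have [up lo] := dotmx_contraction_bounds _ _ _ _ r_ge0 (ltW r_lt1) y_le.
have r1 : 0 < 1 - r%:C :> R[i] by rewrite subr_gt0.
have r2 : 0 < 1 + r%:C :> R[i] by rewrite ltr_wpDr.
rewrite !fmorph_div !rmorphB !rmorphD !rmorph1.
rewrite -![_ / _ * _]mulrAC ler_pdivrMr // ler_pdivlMr //.
by apply/andP; split; [rewrite [leRHS]mulrC|rewrite [leLHS]mulrC].
Qed.

Lemma eigval_cayley_le A (j : 'I_n) (r := singval A j) :
  strict_contraction A -> eigval (cayley_re A) j <= (1 + r) / (1 - r).
Proof.
move=> Ac; have [W rW WH] := cayley_re_rayleigh A j Ac.
apply: (eigval_le_max _ _ _ W) => [||x /WH/andP[]//].
  exact: cayley_re_herm.
by rewrite rW.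
Qed.

Lemma eigval_cayley_ge A (j : 'I_n) (r := singval A j) :
  strict_contraction A -> (1 - r) / (1 + r) <= eigval (cayley_re A) (rev_ord j).
Proof.
move=> Ac; have [W rW WH] := cayley_re_rayleigh A j Ac.
apply: (eigval_ge_min _ _ _ W) => [||x /WH/andP[]//].
  exact: cayley_re_herm.
by rewrite rW /= ltn_sub2l.
Qed.

End Cayley.

(** * The eigenvalue and product inequalities *)

Theorem theorem3 (R : realType) (n : nat) (A H : 'M[R[i]]_n)
    (Acontr : strict_contraction A)
    (defH : H = invmx (1%:M - A^t*) *m (1%:M - A^t* *m A) *m invmx (1%:M - A)) :
  let lambda := eigval H in
  let r := singval A in
  (forall j : 'I_n, lambda j <= (1 + r j) / (1 - r j)) /\
  (forall (k : nat) (i : 'I_k -> 'I_n),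
     (1 <= k <= n)%N -> {homo i : a b / (a < b)%N} ->
     [/\ \prod_(j < k) lambda (i j)
           <= \prod_(j < k) ((1 + r (i j)) / (1 - r (i j))),
         \prod_(j < k) ((1 + r (i j)) / (1 - r (i j)))
           <= \prod_(j < k) ((1 + r j) / (1 - r j)),
         \prod_(j < k) lambda (rev_ord (i j))
           >= \prod_(j < k) ((1 - r (i j) ^+ 2) / (1 + r j) ^+ 2)
       & \prod_(j < k) ((1 - r (i j) ^+ 2) / (1 + r j) ^+ 2)
           >= \prod_(j < k) ((1 - r j) / (1 + r j))]).
Proof.
move=> lambda r.
have upper (j : 'I_n) : lambda j <= (1 + r j) / (1 - r j).
  by rewrite /lambda defH; apply: eigval_cayley_le.
have lower (j : 'I_n) : (1 - r j) / (1 + r j) <= lambda (rev_ord j).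
  by rewrite /lambda defH; apply: eigval_cayley_ge.
have r_ge0 j : 0 <= r j by apply: sqrtr_ge0.
have r_lt1 (j : 'I_n) : r j < 1 by apply: Acontr.
split=> // k i /andP[_ kn] i_incr.
have i_ge (j : 'I_k) : (j <= i j)%N.
  case: j => j jk /=; elim: j jk => // j IHj jk.
  exact: leq_ltn_trans (IHj (ltnW jk)) (i_incr (Ordinal (ltnW jk)) (Ordinal jk) _).
have r_mono (j : 'I_k) : r (i j) <= r j.
  by apply: singval_noninc; rewrite i_ge ltn_ord.
have r_lt1k (j : 'I_k) : r j < 1 by apply: (r_lt1 (widen_ord kn j)).
have lambda_gt0 (j : 'I_n) : 0 < lambda j.
  rewrite -[j]rev_ordK (lt_le_trans _ (lower _)) //.
  by rewrite divr_gt0 ?subr_gt0 ?ltr_wpDr.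
split; apply: ler_prod => j _; apply/andP; split.
- exact: ltW.
- exact: upper.
- by rewrite divr_ge0 ?subr_ge0 ?ltW // ltr_wpDr.
- rewrite ler_pM ?invr_ge0 ?subr_ge0 ?addr_ge0 ?(ltW (r_lt1 _)) ?lerD2l //.
  by rewrite lef_pV2 ?posrE ?subr_gt0 // lerD2l lerN2.
- rewrite divr_ge0 ?subr_ge0 ?exprn_ile1 ?exprn_ge0 ?addr_ge0 //.
  exact: ltW (r_lt1 _).
- apply: le_trans (lower _).
  rewrite ler_pdivrMr ?exprn_gt0 ?ltr_wpDr // mulrAC ler_pdivlMr ?ltr_wpDr //.
  have -> : 1 - r (i j) ^+ 2 = (1 - r (i j)) * (1 + r (i j)) by ring.
  rewrite -!mulrA ler_wpM2l ?subr_ge0 ?(ltW (r_lt1 _)) // -expr2.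
  by rewrite lerXn2r ?nnegrE ?addr_ge0 ?lerD2l.
- by rewrite divr_ge0 ?subr_ge0 ?addr_ge0 // ltW.
- have -> : (1 - r j) / (1 + r j) = (1 - r j ^+ 2) / (1 + r j) ^+ 2.
    by field; rewrite gt_eqF // ltr_wpDr.
  rewrite ler_wpM2r ?invr_ge0 ?exprn_ge0 ?addr_ge0 //.
  by rewrite lerD2l lerN2 lerXn2r ?nnegrE.
Qed.
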